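(* Let $\mathcal{Q}=\mathbb{Q}[x,y]$, where $x^2+y^2+1=0$. Then there exists an epimorphism of groups $$\theta: SL_2(\mathcal{Q})\twoheadrightarrow F_\omega,$$ where $F_\omega$ is the free group of countably infinite rank. In particular, every finitely or countably generated group (including every finite group) is a homomorphic image of $SL_2(\mathcal{Q})$.
   Context: $\mathcal{Q}$ is the ring $\mathbb{Q}[X,Y]/(X^2+Y^2+1)$, with $x,y$ the images of $X,Y$. *)

(* Defs.v *)
From Stdlib Require Import ClassicalEpsilon.
From HB Require Import structures.
From mathcomp Require Import all_boot all_order all_fingroup all_algebra.
From mathcomp Require Import ring_quotient algC.
From mathcomp Require Import mpoly.

Set Implicit Arguments.
Unset Strict Implicit.
Unset Printing Implicit Defensive.

Import GRing.Theory Num.Theory.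

Local Open Scope ring_scope.

Definition conic_poly : {mpoly rat[2]} :=
  'X_ord0 ^+ 2 + 'X_ord_max ^+ 2 + 1.

Definition conic_ideal_spec (p : {mpoly rat[2]}) : Prop :=
  exists q, p = q * conic_poly.

(* ring_quotient asks for a boolean ideal predicate, hence the use of excluded
   middle; see conic_idealP. *)
Definition conic_ideal (p : {mpoly rat[2]}) : bool :=
  if excluded_middle_informative (conic_ideal_spec p) then true else false.

Lemma conic_idealP p : reflect (conic_ideal_spec p) (p \in conic_ideal).
Proof.
rewrite unfold_in /conic_ideal.
by case: excluded_middle_informative => h; constructor.
Qed.

(* Properness: evaluation at the point (i, 0) of the conic. *)
Lemma conic_ideal_closed : idealr_closed conic_ideal.
Proof.
split.
- by apply/conic_idealP; exists 0; rewrite mul0r.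
- apply/conic_idealP => -[q /(congr1 (mmap (@ratr algC)
    (fun i : 'I_2 => if i == ord0 then 'i else 0)))].
  rewrite rmorph1 rmorphM /conic_poly !rmorphD rmorph1 !rmorphXn /=.
  rewrite !mmapX !mmap1U eqxx /= sqrCi expr0n addr0 addNr mulr0.
  by move/eqP; rewrite oner_eq0.
- move=> a _ _ /conic_idealP[u ->] /conic_idealP[v ->].
  by apply/conic_idealP; exists (a * u + v); rewrite mulrDl mulrA.
Qed.

Definition conic_idealr : idealr {mpoly rat[2]} :=
  HB.pack conic_ideal
    (isIdealr.Build {mpoly rat[2]} conic_ideal conic_ideal_closed).

Definition conic_ring : comNzRingType := {ideal_quot conic_idealr}.

Section SpecialLinear.

Variables (n : nat) (R : comNzRingType).

Record SL := MkSL { SLval :> 'M[R]_n; _ : \det SLval == 1 }.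

HB.instance Definition _ := [isSub for SLval].
HB.instance Definition _ := [Choice of SL by <:].

Implicit Types A B C : SL.

Lemma det_SL A : \det A = 1.
Proof. by case: A => M /= /eqP. Qed.

Fact SL1_subproof : \det (1%:M : 'M[R]_n) == 1.
Proof. by rewrite det1. Qed.

Fact SLM_subproof A B : \det (A *m B) == 1.
Proof. by rewrite det_mulmx !det_SL mulr1. Qed.

Fact SLV_subproof A : \det (\adj A) == 1.
Proof.
have: \det (A *m \adj A) = 1 by rewrite mul_mx_adj det_SL det1.
by rewrite det_mulmx det_SL mul1r => ->.
Qed.

Definition SL1 : SL := MkSL SL1_subproof.
Definition SLM A B : SL := MkSL (SLM_subproof A B).
(* The adjugate is the inverse, as the determinant is 1. *)
Definition SLV A : SL := MkSL (SLV_subproof A).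

Fact SLMA : associative SLM.
Proof. by move=> A B C; apply/val_inj; rewrite /= mulmxA. Qed.

Fact SLM1l : left_id SL1 SLM.
Proof. by move=> A; apply/val_inj; rewrite /= mul1mx. Qed.

Fact SLM1r : right_id SL1 SLM.
Proof. by move=> A; apply/val_inj; rewrite /= mulmx1. Qed.

Fact SLMVl : left_inverse SL1 SLV SLM.
Proof. by move=> A; apply/val_inj; rewrite /= mul_adj_mx det_SL. Qed.

Fact SLMVr : right_inverse SL1 SLV SLM.
Proof. by move=> A; apply/val_inj; rewrite /= mul_mx_adj det_SL. Qed.

HB.instance Definition _ := isGroup.Build SL SLMA SLM1l SLM1r SLMVl SLMVr.

End SpecialLinear.

(* The free group on X, as reduced words: the letter (x, false) stands for the
   generator x, and (x, true) for its inverse. *)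
Section FreeGroup.

Variable X : choiceType.

Definition letter : Type := (X * bool)%type.

Definition letterV (a : letter) : letter := (a.1, ~~ a.2).

Definition reduced (w : seq letter) : bool :=
  sorted (fun a b => b != letterV a) w.

Record free_group := FreeGroup { word :> seq letter; _ : reduced word }.

HB.instance Definition _ := [isSub for word].
HB.instance Definition _ := [Choice of free_group by <:].

Definition consr (a : letter) (w : seq letter) : seq letter :=
  if w is b :: w' then if b == letterV a then w' else a :: w else [:: a].

(* The reduced form of u ++ v, for v reduced. *)
Definition catr (u v : seq letter) : seq letter := foldr consr v u.

Definition wordV (w : seq letter) : seq letter := rev (map letterV w).

Lemma letterVK : involutive letterV.
Proof. by case=> x b; rewrite /letterV /= negbK. Qed.

Lemma reduced_consr a w : reduced w -> reduced (consr a w).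
Proof.
case: w => [|b w] //= rw; case: ifPn => [_|nba]; first exact: path_sorted rw.
by rewrite /= nba.
Qed.

Lemma reduced_catr u v : reduced v -> reduced (catr u v).
Proof. by move=> rv; elim: u => //= a u; apply: reduced_consr. Qed.

Lemma consr_reduced a w : reduced (a :: w) -> consr a w = a :: w.
Proof. by case: w => [|b w] //= /andP[/negPf->]. Qed.

Lemma catr_nil u : reduced u -> catr u [::] = u.
Proof.
elim: u => //= a u IHu rau.
by rewrite IHu ?consr_reduced //; apply: path_sorted rau.
Qed.

Lemma consrVK a w : reduced w -> consr (letterV a) (consr a w) = w.
Proof.
case: w => [|b w] /=; first by rewrite letterVK eqxx.
move=> rw; case: ifPn => [/eqP Db|_]; last by rewrite /= letterVK eqxx.
by rewrite -Db consr_reduced.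
Qed.

Lemma catr_consr a u v :
  reduced v -> catr (consr a u) v = consr a (catr u v).
Proof.
move=> rv; case: u => [|b u] //=; case: eqP => //= ->.
by rewrite -{1}[a]letterVK consrVK // reduced_catr.
Qed.

Lemma catrA u v w : reduced w -> catr u (catr v w) = catr (catr u v) w.
Proof. by move=> rw; elim: u => //= a u ->; rewrite catr_consr. Qed.

Lemma catr_cat u v w : catr (u ++ v) w = catr u (catr v w).
Proof. exact: foldr_cat. Qed.

Lemma catVrK u w : reduced w -> catr (wordV u) (catr u w) = w.
Proof.
move=> rw; elim: u => //= a u IHu.
rewrite /wordV /= rev_cons -cats1 catr_cat /= consrVK ?reduced_catr //.
Qed.

Lemma wordVK : involutive wordV.
Proof. by move=> u; rewrite /wordV map_rev revK mapK //; apply: letterVK. Qed.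

Lemma reduced_wordV w : reduced w -> reduced (wordV w).
Proof.
rewrite /reduced /wordV rev_sorted sorted_map; apply: sub_sorted => a b /=.
by apply: contraNN => /eqP ->; rewrite letterVK.
Qed.

Lemma reduced_word (g : free_group) : reduced g.
Proof. by case: g. Qed.

Definition freeg1 : free_group := @FreeGroup [::] isT.
Definition freegM (g h : free_group) : free_group :=
  FreeGroup (reduced_catr g (reduced_word h)).
Definition freegV (g : free_group) : free_group :=
  FreeGroup (reduced_wordV (reduced_word g)).

Fact freegMA : associative freegM.
Proof. by move=> f g h; apply/val_inj/catrA/reduced_word. Qed.

Fact freegM1l : left_id freeg1 freegM.
Proof. by move=> g; apply/val_inj. Qed.

Fact freegM1r : right_id freeg1 freegM.
Proof. by move=> g; apply/val_inj/catr_nil/reduced_word. Qed.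

Fact freegMVl : left_inverse freeg1 freegV freegM.
Proof.
move=> g; apply/val_inj => /=.
by rewrite -{2}(catr_nil (reduced_word g)) catVrK.
Qed.

Fact freegMVr : right_inverse freeg1 freegV freegM.
Proof.
move=> g; apply/val_inj => /=; rewrite -{1}[word g]wordVK.
by rewrite -{2}(catr_nil (reduced_wordV (reduced_word g))) catVrK.
Qed.

HB.instance Definition _ :=
  isGroup.Build free_group freegMA freegM1l freegM1r freegMVl freegMVr.

End FreeGroup.

Definition F_omega : groupType := free_group nat.

Section Generation.

Variable G : groupType.

Local Open Scope group_scope.

Inductive generated (S : G -> Prop) : G -> Prop :=
| generated_mem x : S x -> generated S x
| generated1 : generated S 1
| generatedM x y : generated S x -> generated S y -> generated S (x * y)
| generatedV x : generated S x -> generated S x^-1.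

Definition finitely_generated : Prop :=
  exists s : seq G, forall x, generated (fun g => g \in s) x.

(* Repetitions are allowed, so finite generating families are covered too. *)
Definition countably_generated : Prop :=
  exists s : nat -> G, forall x, generated (fun g => exists i, g = s i) x.

End Generation.

Definition surjective (T U : Type) (f : T -> U) : Prop :=
  forall y, exists x, f x = y.

Definition homomorphic_image (G H : groupType) : Prop :=
  exists f : {multiplicative G -> H}, surjective f.

(* Main.v *)
(* SL_2 of the conic ring acts on a Bruhat-Tits tree.  With [t = 1 / pi], the
   substitution [x = (t - 1 / t) / 2], [y = - i (x + 1 / t)] embeds the conic
   ring in the valued field [algC(pi)], and the only elements of its image that
   are regular at [pi = 0] are the rational constants.  Hence the stabiliser of
   the standard vertex is SL_2(Q), and the edges leaving this vertex in the
   directions [a i] and [b i], for [a] and [b] rational, can be conjugate only if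
   [a b] is a sum of two squares.  On the other hand, when [a] is a sum of four
   squares, some element of the group moves the end of the edge [a i] to the end
   of the edge [i].  So the quotient graph has infinitely many edges between two
   of its vertices, and its fundamental group maps onto [F_omega].  Concretely,
   the invariant labelling of the orbit of the edge [c_k i] by the inverse of the
   k-th generator, for pairwise coprime [c_k = P_k ^ 2 + 2] congruent to 3 modulo
   4, integrates to a morphism, since the tree is simply connected. *)
Require Import Defs.
From Stdlib Require Import ClassicalEpsilon.
From HB Require Import structures.
From mathcomp Require Import all_boot all_fingroup all_algebra all_field.
From mathcomp Require Import generic_quotient ring_quotient mpoly.
From mathcomp Require Import ring zify.

Set Implicit Arguments.
Unset Strict Implicit.
Unset Printing Implicit Defensive.

(** * Integration of edge labellings *)

Section Potential.

Local Open Scope group_scope.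

Definition subgroup_closed (G : groupType) (H : G -> Prop) : Prop :=
  [/\ H 1, forall x y, H x -> H y -> H (x * y) & forall x, H x -> H x^-1].

(* [P0] and [P1] are the stabilisers of the two vertices of the standard edge of
   a tree on which [G] acts edge-transitively, and [B] stabilises an end of the
   tree; [tau] translates the tree towards the end by two steps along a line. *)
Variables (G F : groupType) (B P0 P1 : G -> Prop) (w w1 : G).

Let tau := w1 * w^-1.
Let Iw x := P0 x /\ P1 x.

Hypotheses (groupB : subgroup_closed B) (group0 : subgroup_closed P0).
Hypotheses (group1 : subgroup_closed P1).
Hypotheses (P0w : P0 w) (P1w1 : P1 w1) (Btau : B tau).
Hypothesis BP0 : forall g, exists b p, [/\ B b, P0 p & g = b * p].
Hypothesis BsubP1 : forall b, B b -> P0 b -> P1 b.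
Hypothesis bruhat0 : forall p, P0 p ->
  Iw p \/ exists b i, [/\ B b, P0 b, Iw i & p = b * w * i].
Hypothesis bruhat1 : forall p, P1 p ->
  exists i, Iw i /\ (p = w1 * i \/ exists b, [/\ B b, P1 b & p = b * i]).
Hypothesis conj_tau : forall b, B b -> P1 b -> P0 (b ^ tau).
Hypothesis conj_w1 : forall b, B b -> P1 b -> Iw (b ^ w1).
Hypothesis tau_contracts : forall b, B b ->
  exists k l c, [/\ B c, P0 c & b * tau ^+ k = tau ^+ l * c].
Hypothesis tau_free : forall n, ~ P0 (tau ^+ n.+1).

Let B1 : B 1. Proof. by case: groupB. Qed.
Let BM x y : B x -> B y -> B (x * y). Proof. by case: groupB => _ + _; apply. Qed.
Let BV x : B x -> B x^-1. Proof. by case: groupB => _ _; apply. Qed.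
Let P01 : P0 1. Proof. by case: group0. Qed.
Let P0M x y : P0 x -> P0 y -> P0 (x * y).
Proof. by case: group0 => _ + _; apply. Qed.
Let P0V x : P0 x -> P0 x^-1. Proof. by case: group0 => _ _; apply. Qed.
Let P1M x y : P1 x -> P1 y -> P1 (x * y).
Proof. by case: group1 => _ + _; apply. Qed.
Let tau_w : tau * w = w1. Proof. by rewrite /tau mulgVK. Qed.

(** This is connectedness of the tree. Since [tau] is an element of [P1] times one of [P0], [f] is
    invariant under right multiplication by [tau]; contraction turns any [b] in [B], after some
    steps, into a power of [tau] times an element of [P0]. *)
Lemma constant_on_amalgam (T : Type) (f : G -> T) :
    (forall g p, P0 p -> f (g * p) = f g) ->
    (forall g p, P1 p -> f (g * p) = f g) ->
  forall g, f g = f 1.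
Proof.
move=> f0 f1 g; have [b [p [Bb P0p ->]]] := BP0 g.
have ftau x n : f (x * tau ^+ n) = f x.
  elim: n => [|n IHn]; first by rewrite expg0 mulg1.
  by rewrite expgSr mulgA [_ * tau]mulgA f0 1?f1 //; apply: P0V.
have [k [l [c [_ P0c bkl]]]] := tau_contracts Bb.
by rewrite f0 // -(ftau b k) bkl f0 // -[tau ^+ l]mul1g ftau.
Qed.

Section Labelling.

Variable lam : G -> F.
Hypothesis lam_Iw : forall g i, P0 i -> P1 i -> lam (g * i) = lam g.

Definition ray_label b : F := lam b * (lam (b * w1))^-1.
Notation mu := ray_label.

(** Total label along the first [k] double steps of the ray from the vertex [b P0]. *)
Let A b k : F := \prod_(j < k) mu (b * tau ^+ j).

Let A0 b : A b 0 = 1. Proof. exact: big_ord0. Qed.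

Let AS b k : A b k.+1 = A b k * mu (b * tau ^+ k).
Proof. exact: big_ord_recr. Qed.

Let conj_tauX c n : B c -> P0 c -> B (c ^ (tau ^+ n)) /\ P0 (c ^ (tau ^+ n)).
Proof.
move=> Bc Pc; elim: n => [|n [IHB IHP]]; first by rewrite expg0 conjg1.
rewrite expgSr conjgM; split; last by apply: conj_tau => //; apply: BsubP1.
by rewrite conjgE; apply/BM/BM/Btau => //; apply: BV.
Qed.

Let mu_B0 b c : B c -> P0 c -> mu (b * c) = mu b.
Proof.
move=> Bc Pc; have Pc1 := BsubP1 Bc Pc; have [? ?] := conj_w1 Bc Pc1.
by rewrite /mu lam_Iw // -mulgA [c * w1]conjgC mulgA (lam_Iw (b * w1)).
Qed.

Let A_B0 b c k : B c -> P0 c -> A (b * c) k = A b k.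
Proof.
move=> Bc Pc; apply: eq_bigr => j _; have [? ?] := conj_tauX j Bc Pc.
by rewrite -mulgA [c * _]conjgC mulgA mu_B0.
Qed.

Let A_shift b k : A b k.+1 = mu b * A (b * tau) k.
Proof.
rewrite /A big_ord_recl expg0 mulg1; congr (_ * _).
by apply: eq_bigr => j _; rewrite expgS mulgA.
Qed.

(** The ray from [b P0] after [k] double steps meets the base ray after [l]. As [c] lies in [B], the
    two rays coincide from there on, and later labels cancel. *)
Let valid b k l := exists c, [/\ B c, P0 c & b * tau ^+ k = tau ^+ l * c].

Let valid_addn b k l d : valid b k l ->
  valid b (k + d) (l + d) /\
  A 1 (l + d) * (A b (k + d))^-1 = A 1 l * (A b k)^-1.
Proof.
move=> v; elim: d => [|d [[c [Bc Pc Ec]] IHd]]; first by rewrite !addn0.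
split.
  have [] := conj_tauX 1 Bc Pc; rewrite expg1 => ? ?.
  by exists (c ^ tau); rewrite !addnS !expgSr mulgA Ec -mulgA [c * _]conjgC mulgA.
rewrite !addnS !AS invgM mul1g Ec mu_B0 // -IHd.
by rewrite [LHS]mulgA mulgK.
Qed.

Let tauX_inj m n c : P0 c -> tau ^+ m = tau ^+ n * c -> m = n.
Proof.
have half m' n' c' : P0 c' -> tau ^+ m' = tau ^+ n' * c' -> (m' <= n')%N.
  move=> Pc E; rewrite leqNgt; apply/negP => lt_nm.
  case: (@tau_free (m' - n').-1); rewrite prednK ?subn_gt0 //.
  suff -> : tau ^+ (m' - n') = c' by [].
  by apply: (@mulgI _ (tau ^+ n')); rewrite -expgnDr subnKC // ltnW.
move=> Pc E; apply/eqP; rewrite eqn_leq (half _ _ _ Pc E).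
by apply: (half _ _ c^-1); rewrite ?E ?mulgK //; apply: P0V.
Qed.

Let valid_uniq b k l l' : valid b k l -> valid b k l' -> l = l'.
Proof.
move=> [c [_ Pc E]] [c' [_ Pc' E']].
apply: (@tauX_inj _ _ (c' * c^-1)); first exact/P0M/P0V.
by rewrite mulgA -E' E mulgK.
Qed.

Let valid_eq b k l k' l' : valid b k l -> valid b k' l' ->
  A 1 l * (A b k)^-1 = A 1 l' * (A b k')^-1.
Proof.
wlog le_kk' : k l k' l' / (k <= k')%N => [hw|] v v'.
  by case: (leqP k k') => [|/ltnW] le_k; [exact: hw | apply/esym/hw].
have [v2 <-] := valid_addn (k' - k) v; rewrite subnKC // in v2 *.
by rewrite (valid_uniq v' v2).
Qed.

(** Go out along the base ray to the meeting point, then back along the ray from [g P0]. *)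
Let potential_at g y := exists b p k l,
  [/\ B b, P0 p, g = b * p, valid b k l & y = A 1 l * (A b k)^-1].

Let potential_ex g : exists y, potential_at g y.
Proof.
have [b [p [Bb Pp ->]]] := BP0 g; have [k [l v]] := tau_contracts Bb.
by exists (A 1 l * (A b k)^-1), b, p, k, l.
Qed.

(** Two decompositions of [g] differ by an element [c] of both [B] and [P0]. It fixes the vertex and
    the end, hence the ray between them, so both give the same labels. *)
Let potential_uniq g y y' : potential_at g y -> potential_at g y' -> y = y'.
Proof.
move=> [b [p [k [l [Bb Pp -> v ->]]]]] [b' [p' [k' [l' [Bb' Pp' E v' ->]]]]].
pose c := p * p'^-1; have Pc : P0 c by exact/P0M/P0V.
have Eb' : b' = b * c by rewrite mulgA E mulgK.
have Bc : B c by rewrite -[c](mulKg b) -Eb'; apply: BM => //; apply: BV.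
rewrite Eb' A_B0 //; apply: valid_eq v _.
case: v' => d [Bd Pd Ed]; have [? ?] := conj_tauX k' Bc Pc.
exists (d * (c ^ tau ^+ k')^-1); split; [exact/BM/BV | exact/P0M/P0V |].
by rewrite mulgA -Ed Eb' -[b * c * _]mulgA [c * _]conjgC mulgA mulgK.
Qed.

Let h g := proj1_sig (constructive_indefinite_description _ (potential_ex g)).

Let hP g : potential_at g (h g).
Proof. by rewrite /h; case: constructive_indefinite_description. Qed.

Let h_P0 g p : P0 p -> h (g * p) = h g.
Proof.
move=> Pp; apply: potential_uniq (hP _) _.
have [b [q [k [l [Bb Pq Eg v E]]]]] := hP g.
by exists b, (q * p), k, l; split=> //; rewrite ?Eg ?mulgA //; apply: P0M.
Qed.

Let h_tau b : B b -> h (b * tau) = h b * mu b.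
Proof.
move=> Bb; have [k [l v]] := tau_contracts Bb.
have [[c [Bc Pc Ec]] _] := valid_addn 1 v; rewrite !addn1 in Ec.
have -> : h b = A 1 l.+1 * (A b k.+1)^-1.
  apply: potential_uniq (hP b) _; exists b, 1, k.+1, l.+1.
  by rewrite mulg1; split=> //; exists c.
rewrite (A_shift b) invgM [A 1 _ * _]mulgA mulgVK; apply: potential_uniq (hP _) _.
exists (b * tau), 1, k, l.+1; rewrite mulg1; split=> //; first exact: BM.
by exists c; rewrite -Ec expgS !mulgA.
Qed.

(* A tree is simply connected, so an edge labelling integrates to a potential on
   the vertices.  It is computed along the ray from a vertex to the end fixed by
   [B]: the vertices [b P0] and [b tau P0] of that ray are at distance two, and
   [ray_label b] is the label of the path between them. *)
Lemma edge_labelling_potential : exists h : G -> F,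
  [/\ h 1 = 1, forall g p, P0 p -> h (g * p) = h g &
      forall g p, P1 p -> h (g * p) * lam (g * p) = h g * lam g].
Proof.
exists h; split=> //.
  apply: potential_uniq (hP 1) _; exists 1, 1, 0, 0.
  split; rewrite ?A0 ?invg1 ?mulg1 //.
  by exists 1; split; rewrite ?mulg1.
have step b : B b -> h (b * w1) * lam (b * w1) = h b * lam b.
  move=> Bb; rewrite -tau_w mulgA h_P0 // h_tau // -[b * tau * w]mulgA tau_w.
  by rewrite mulgA mulgVK.
have reduced b p : B b -> P1 p -> h (b * p) * lam (b * p) = h b * lam b.
  move=> Bb /bruhat1[i [[P0i P1i] [->|[u [Bu P1u ->]]]]].
    by rewrite mulgA h_P0 1?lam_Iw ?step.
  rewrite mulgA h_P0 1?lam_Iw // -step; last exact: BM.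
  rewrite -mulgA [u * w1]conjgC mulgA -[RHS]step //.
  have [? ?] := conj_w1 Bu P1u.
  by rewrite (h_P0 (b * w1)) 1?(lam_Iw (b * w1)).
(* Since [w = tau^-1 * w1], the big Bruhat cell of [P0] falls into [B P1]: [B] is transitive on the
   second type of vertices too. *)
have BP1 g : exists b p, [/\ B b, P1 p & g = b * p].
  have [b [p [Bb P0p ->]]] := BP0 g.
  case: (bruhat0 P0p) => [[_ P1p]|[u [i [Bu P0u [_ P1i] ->]]]]; first by exists b, p.
  exists (b * u * tau^-1), (w1 * i); split; [|exact: P1M|].
    by apply: BM; [exact: BM|exact: BV].
  by rewrite -tau_w -[tau * w * i]mulgA [RHS]mulgA mulgVK !mulgA.
move=> g p P1p; have [b [q [Bb P1q ->]]] := BP1 g.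
by rewrite -mulgA !reduced //; apply: P1M.
Qed.

(** Translating the potential by [iota c] gives another potential of the same invariant labelling,
    so the two differ by a constant left factor [theta c], which is multiplicative in [c]. In the
    last formula, [iota c] carries the far end of the edge [u] to that of the edge [v]: the base
    vertex is joined to its image by the edges [v] and [iota c * u]. *)
Lemma tree_action_morphism (Gamma : groupType)
    (iota : {multiplicative Gamma -> G}) :
    (forall c g, lam (iota c * g) = lam g) ->
  exists theta : {multiplicative Gamma -> F},
  forall c u v, P0 u -> P0 v -> P1 (v^-1 * iota c * u) ->
    theta c = lam v * (lam u)^-1.
Proof.
move=> lam_iota; have [pot [pot1 pot_P0 pot_P1]] := edge_labelling_potential.
pose theta c := pot (iota c).
have thetaE c g : pot (iota c * g) = theta c * pot g.
  pose f x := pot (iota c * x) * (pot x)^-1.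
  have f0 x p : P0 p -> f (x * p) = f x.
    by move=> P0p; rewrite /f mulgA (pot_P0 (_ * x)) // (pot_P0 x).
  have f1 x p : P1 p -> f (x * p) = f x.
    move=> P1p; have E y : pot (y * p) = pot y * lam y * (lam (y * p))^-1.
      by rewrite -(pot_P1 _ p) // mulgK.
    by rewrite /f mulgA !E !invgM -[iota c * x * p]mulgA !lam_iota !invgK
      !mulgA mulgVK mulgK.
  have := constant_on_amalgam f0 f1 g; rewrite /f mulg1 pot1 invg1 mulg1.
  by rewrite /theta => <-; rewrite mulgVK.
have thetaM : {morph theta : c d / c * d >-> c * d}.
  by move=> c d; rewrite /theta gmulfM thetaE.
pose thetaHB := isMultiplicative.Build Gamma F theta thetaM.
exists (HB.pack_for {multiplicative Gamma -> F} theta thetaHB) => c u v.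
move=> P0u P0v P1p /=; set p := _ * u in P1p.
have E : iota c * u = v * p by rewrite /p -mulgA mulVKg.
have := pot_P1 v _ P1p; rewrite -E lam_iota pot_P0 // -/(theta c).
have -> : pot v = 1 by rewrite -[v]mul1g pot_P0.
by rewrite mul1g => <-; rewrite mulgK.
Qed.

End Labelling.

End Potential.

(** * Images of free groups *)

Section FreeGroupImages.

Local Open Scope group_scope.

Lemma surjective_on_generators (G H : groupType) (f : {multiplicative G -> H})
    (S : H -> Prop) :
    (forall y, Defs.generated S y) ->
    (forall y, S y -> exists x, f x = y) ->
  surjective f.
Proof.
have f1 : f 1 = 1 by apply: (@mulgI _ (f 1)); rewrite -gmulfM !mulg1.
move=> genS imS y; elim: (genS y) => [z /imS //||_ _ _ [x <-] _ [z <-]|_ _ [x <-]].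
- by exists 1.
- by exists (x * z); rewrite gmulfM.
- by exists x^-1; apply: (@mulgI _ (f x)); rewrite -gmulfM !mulgV.
Qed.

Section Universal.

Variables (X : choiceType) (G : groupType) (s : X -> G).

Definition letter_value (a : letter X) : G :=
  if a.2 then (s a.1)^-1 else s a.1.

Definition word_value (w : free_group X) : G := \prod_(a <- word w) letter_value a.

Let word_valueM : {morph word_value : u v / u * v}.
Proof.
have valueV a : letter_value (letterV a) = (letter_value a)^-1.
  by case: a => x [] /=; rewrite /letter_value /= ?invgK.
move=> u v; rewrite /word_value /= /catr.
elim: (word u) => [|a w IHw] /=; first by rewrite big_nil mul1g.
rewrite big_cons -mulgA -IHw; case: (foldr _ _ w) => [|b t] /=.
  by rewrite big_seq1 big_nil mulg1.
case: eqP => [->|_]; last by rewrite big_cons.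
by rewrite big_cons valueV mulKVg.
Qed.

HB.instance Definition _ :=
  isMultiplicative.Build (free_group X) G word_value word_valueM.

Definition free_gen (x : X) : free_group X := @FreeGroup X [:: (x, false)] isT.

Lemma word_value_gen x : word_value (free_gen x) = s x.
Proof. by rewrite /word_value big_seq1. Qed.

End Universal.

Lemma free_group_generated (X : choiceType) (w : free_group X) :
  Defs.generated (fun g => exists x, g = free_gen x) w.
Proof.
case: w => w; elim: w => [|[x b] w IHw] rw.
  rewrite (_ : FreeGroup rw = 1); [exact: Defs.generated1 | exact/val_inj].
have rw' : reduced w := path_sorted rw.
pose a : free_group X := @FreeGroup X [:: (x, b)] isT.
have -> : FreeGroup rw = a * FreeGroup rw'.
  by apply: val_inj; rewrite /= consr_reduced.
apply: Defs.generatedM (IHw rw').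
have gx : Defs.generated (fun g => exists x, g = free_gen x) (free_gen x).
  by apply: Defs.generated_mem; exists x.
case: b @a rw => a _; last by rewrite (_ : a = free_gen x) //; apply: val_inj.
rewrite (_ : a = (free_gen x)^-1); first exact: Defs.generatedV.
exact: val_inj.
Qed.

Lemma F_omega_image (G : groupType) : countably_generated G ->
  homomorphic_image F_omega G.
Proof.
case=> s gen_s; exists (word_value s).
apply: surjective_on_generators gen_s _ => _ [i ->].
by exists (free_gen i); exact: word_value_gen.
Qed.

Lemma generated_sub (G : groupType) (S S' : G -> Prop) x :
  (forall y, S y -> S' y) -> Defs.generated S x -> Defs.generated S' x.
Proof.
move=> SS'; elim=> [y /SS'||y z _ ? _|y _]; first exact: Defs.generated_mem.
- exact: Defs.generated1.
- exact: Defs.generatedM.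
- exact: Defs.generatedV.
Qed.

Lemma finitely_generated_countable (G : groupType) :
  finitely_generated G -> countably_generated G.
Proof.
(* Past the end of [s] the default value [1] is enumerated, which does no harm. *)
case=> s gen_s; exists (nth 1 s) => x.
by apply: generated_sub (gen_s x) => y /(nthP 1)[i _ <-]; exists i.
Qed.

Lemma finite_generated (G : finGroupType) : finitely_generated G.
Proof.
by exists (enum G) => x; apply: Defs.generated_mem; rewrite mem_enum.
Qed.

Lemma homomorphic_image_trans (G H K : groupType) :
  homomorphic_image G H -> homomorphic_image H K -> homomorphic_image G K.
Proof.
case=> f f_surj [g g_surj].
exists (g \o f) => z; have [y <-] := g_surj z; have [x <-] := f_surj y.
by exists x.
Qed.

End FreeGroupImages.

Import GRing.Theory Num.Theory.

Local Open Scope ring_scope.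

(** * Sums of two squares *)

(** For [p = 4m + 3], Fermat gives [z^2 = z^(p+1)], an even power of [z^2]. This erases the sign in
    [x^2 = - y^2], whence [2 x^2 = 0] modulo [p]. *)
Lemma dvdn_sum_squares p a b : prime p -> (p %% 4 = 3)%N ->
  (p %| a ^ 2 + b ^ 2)%N -> (p %| a)%N.
Proof.
move=> p_pr p3; rewrite !(dvdn_pcharf (pchar_Fp p_pr)) natrD !natrX.
set x := a%:R; set y := b%:R => /eqP xy0.
have Fermat (z : 'F_p) : z ^+ p = z.
  by rewrite -[X in _ ^+ X](card_Fp p_pr) expf_card.
have [m pE] : exists m, p = (4 * m + 3)%N by exists (p %/ 4)%N; lia.
have sq (z : 'F_p) : z ^+ 2 = (z ^+ 2) ^+ (2 * m.+1)%N.
  rewrite -exprM (_ : 2 * (2 * m.+1) = p.+1)%N; last by lia.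
  by rewrite [RHS]exprS Fermat expr2.
have xE : x ^+ 2 = - y ^+ 2 by apply/eqP; rewrite -addr_eq0 xy0.
have : x ^+ 2 + x ^+ 2 == 0.
  have E : x ^+ 2 = y ^+ 2.
    by rewrite (sq x) (sq y) xE [(- _) ^+ _]exprM sqrrN [RHS]exprM.
  by rewrite {1}E xE subrr.
rewrite -mulr2n -mulr_natr mulf_eq0 -(dvdn_pcharf (pchar_Fp p_pr)).
rewrite expf_eq0 /= => /orP[//|/(dvdn_leq (isT : 0 < 2)%N)]; lia.
Qed.

(** Descent: if [p] divides the sum, it divides [a] and [b], and dividing both by [p] lowers the
    exponent by two. *)
Lemma odd_logn_sum_squares p a b : prime p -> (p %% 4 = 3)%N ->
  ~~ odd (logn p (a ^ 2 + b ^ 2)).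
Proof.
move=> p_pr p3; have [n] := ubnP (a + b)%N.
elim: n a b => // n IHn a b /ltnSE le_ab_n.
have [p_ab|/negPf np] := boolP (p %| a ^ 2 + b ^ 2)%N; last first.
  by rewrite lognE np !andbF.
have := dvdn_sum_squares p_pr p3 p_ab; rewrite addnC in p_ab.
have /dvdnP[b' Eb] := dvdn_sum_squares p_pr p3 p_ab.
move=> /dvdnP[a' Ea].
have [ab0|ab_gt0] := posnP (a ^ 2 + b ^ 2)%N; first by rewrite ab0 logn0.
have E : (a ^ 2 + b ^ 2 = p ^ 2 * (a' ^ 2 + b' ^ 2))%N by rewrite Ea Eb; ring.
have a'b'_gt0 : (0 < a' ^ 2 + b' ^ 2)%N by move: ab_gt0; rewrite E muln_gt0 => /andP[].
have p_gt0 := prime_gt0 p_pr.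
rewrite E lognM ?expn_gt0 ?p_gt0 // lognX oddD oddM /=.
apply: IHn.
have : (0 < a' + b')%N.
  rewrite lt0n; apply: contraTneq a'b'_gt0 => /eqP; rewrite addn_eq0.
  by move=> /andP[/eqP-> /eqP->].
move: le_ab_n; rewrite Ea Eb -mulnDl => le_n ab_gt0'.
by apply: leq_trans le_n; rewrite ltn_Pmulr // prime_gt1.
Qed.

(** Strip the least prime factor [p]. If it is 1 modulo 4, the cofactor is still 3 modulo 4. If it
    is 3 with even exponent, then [p^2] divides [n], and [n / p^2] is still 3 modulo 4 with the same
    parities of exponents. *)
Lemma odd_logn_3mod4 n : (n %% 4 = 3)%N ->
  exists p, [/\ prime p, (p %% 4 = 3)%N & odd (logn p n)].
Proof.
have [m] := ubnP n; elim: m n => // m IHm n /ltnSE le_nm n3.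
have n_gt1 : (1 < n)%N by case: (n) n3 => [|[|]].
set p := pdiv n; have p_pr : prime p := pdiv_prime n_gt1.
have p_gt1 := prime_gt1 p_pr.
have /dvdnP[k nE] : (p %| n)%N := pdiv_dvd n.
have n_gt0 := ltnW n_gt1.
have k_gt0 : (0 < k)%N by case: (k) nE n_gt0 => // ->.
have oddn : odd n by lia.
have odd_pk : odd k && odd p by rewrite -oddM -nE.
have kn : (k < n)%N by rewrite nE ltn_Pmulr.
have [p1|p3] : (p %% 4 = 1 \/ (p %% 4 = 3)%N)%N by case/andP: odd_pk; lia.
  have k3 : (k %% 4 = 3)%N by move: n3; rewrite nE -modnMm p1 muln1 modn_mod.
  have [q [q_pr q3 oddq]] := IHm k (leq_trans kn le_nm) k3.
  exists q; split=> //; rewrite nE lognM ?(ltnW p_gt1) // oddD oddq.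
  rewrite [logn q p]lognE q_pr (ltnW p_gt1) /= (_ : (q %| p)%N = false) //.
  by rewrite dvdn_prime2 //; apply/eqP => qp; rewrite qp p1 in q3.
have k1 : (k %% 4 = 1)%N.
  have : (k %% 4 = 1 \/ (k %% 4 = 3)%N)%N by case/andP: odd_pk; lia.
  case=> // k3; move: n3; by rewrite nE -modnMm p3 k3.
have [odd_log|even_log] := boolP (odd (logn p n)); first by exists p.
have /dvdnP[l kE] : (p %| k)%N.
  apply: contraNT even_log => pk; rewrite nE lognM ?(ltnW p_gt1) //.
  by rewrite -(expn1 p) pfactorK // lognE (negPf pk) !andbF.
have l3 : (l %% 4 = 3)%N.
  have : (l %% 4 = 0 \/ l %% 4 = 1 \/ l %% 4 = 2 \/ (l %% 4 = 3)%N)%N by lia.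
  by move: k1; rewrite kE -modnMm p3 => + [|[|[|]]] l_4; rewrite l_4.
have l_gt0 : (0 < l)%N by case: (l) l3.
have lk : (l < k)%N by rewrite kE ltn_Pmulr.
have [q [q_pr q3 oddq]] := IHm l (leq_trans (ltn_trans lk kn) le_nm) l3.
exists q; split=> //; rewrite nE kE -mulnA lognM ?muln_gt0 ?(ltnW p_gt1) //.
by rewrite oddD oddq lognM ?(ltnW p_gt1) // oddD addbb.
Qed.

Definition sum_of_two_squares (r : rat) := exists u v, r = u ^+ 2 + v ^+ 2.

Lemma sum_of_two_squares_even p n : prime p -> (p %% 4 = 3)%N -> (0 < n)%N ->
  sum_of_two_squares n%:R -> ~~ odd (logn p n).
Proof.
move=> p_pr p3 n_gt0 [u [v E]].
pose a := absz (numq u * denq v); pose b := absz (numq v * denq u).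
pose d := absz (denq u * denq v).
have d_gt0 : (0 < d)%N by rewrite absz_gt0 mulf_neq0 ?denq_neq0.
have sqr_absz (z : int) : (absz z)%:R ^+ 2 = z%:~R ^+ 2 :> rat.
  by rewrite natr_absz intr_norm real_normK ?num_real.
have ED : (n * d ^ 2 = a ^ 2 + b ^ 2)%N.
  apply/eqP; rewrite -(eqr_nat rat) natrM natrD !natrX !sqr_absz E !intrM.
  have du : (denq u)%:~R != 0 :> rat by rewrite intr_eq0 denq_neq0.
  have dv : (denq v)%:~R != 0 :> rat by rewrite intr_eq0 denq_neq0.
  rewrite -{1}(divq_num_den u) -{1}(divq_num_den v); apply/eqP.
  by field; rewrite du dv.
have := odd_logn_sum_squares a b p_pr p3.
by rewrite -ED lognM ?expn_gt0 ?d_gt0 // lognX oddD oddM addbF.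
Qed.

(** Euclid's recursion: the product of the [radicand j] with [j < k]. Each radicand is thus 2 modulo
    the earlier ones, which are odd, and it is a sum of squares [P^2 + 1 + 1], a quaternion norm. *)
Fixpoint radicand_prod k : nat :=
  if k is k'.+1 then (radicand_prod k' * (radicand_prod k' ^ 2 + 2))%N else 1%N.

Definition radicand k : nat := (radicand_prod k ^ 2 + 2)%N.

Lemma odd_radicand_prod k : odd (radicand_prod k).
Proof. by elim: k => //= k IHk; rewrite oddM oddD oddX IHk orbT. Qed.

Lemma radicand_mod4 k : (radicand k %% 4 = 3)%N.
Proof.
have := odd_radicand_prod k; rewrite /radicand; set n := radicand_prod k => odd_n.
have [m ->] : exists m, n = (2 * m + 1)%N by exists n./2; lia.
by rewrite (_ : _ + 2 = (m ^ 2 + m) * 4 + 3)%N ?modnMDl //; ring.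
Qed.

Lemma coprime_radicand j k : j != k -> coprime (radicand j) (radicand k).
Proof.
wlog lt_jk : j k / (j < k)%N => [hw|_].
  case: ltngtP => // lt_jk _; first by apply: hw; rewrite ?ltn_eqF.
  by rewrite coprime_sym; apply: hw; rewrite ?ltn_eqF.
have dvd_jk : (radicand j %| radicand_prod k)%N.
  elim: k lt_jk => // k IHk /ltnSE; rewrite leq_eqVlt => /predU1P[->|/IHk].
    exact: dvdn_mull.
  exact: dvdn_mulr.
apply: coprime_dvdl dvd_jk _; rewrite /radicand; set n := radicand_prod k.
rewrite expnS expn1 /coprime gcdnMDl -/(coprime _ _).
by rewrite coprimen2 odd_radicand_prod.
Qed.

Lemma radicand_gt0 k : (0 < radicand k)%N.
Proof. by rewrite /radicand addn2. Qed.

Lemma radicand_not_sum k : ~ sum_of_two_squares (radicand k)%:R.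
Proof.
have [p [p_pr p3 odd_log]] := odd_logn_3mod4 (radicand_mod4 k).
move/(sum_of_two_squares_even p_pr p3 (radicand_gt0 k)).
by rewrite odd_log.
Qed.

(** For [j != k], a prime that is 3 modulo 4 and has odd exponent in [radicand j] does not divide
    the coprime [radicand k], so its exponent in the product stays odd. *)
Lemma radicand_mul_not_sum j k :
  sum_of_two_squares (radicand j * radicand k)%:R -> j = k.
Proof.
move=> sum_jk; apply/eqP; apply: contraPT sum_jk => ne_jk.
have [p [p_pr p3 odd_log]] := odd_logn_3mod4 (radicand_mod4 j).
have gt0 : (0 < radicand j * radicand k)%N by rewrite muln_gt0 !radicand_gt0.
move/(sum_of_two_squares_even p_pr p3 gt0).
rewrite lognM ?radicand_gt0 // oddD odd_log logn_coprime //.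
apply: coprime_dvdl (coprime_radicand ne_jk).
by apply: contraTT odd_log => /negPf npj; rewrite lognE npj !andbF.
Qed.

(** * The tree of SL_2 over a valued field *)

Lemma sum_I2 (V : nmodType) (f : 'I_2 -> V) : \sum_(i < 2) f i = f 0 + f 1.
Proof. by rewrite big_ord_recl big_ord1; congr (_ + f _); apply: val_inj. Qed.

Section SL2Entries.

Variable R : comNzRingType.
Implicit Types A B : SL 2 R.

Definition mx2 (a b c d : R) : 'M[R]_2 :=
  \matrix_(i < 2, j < 2)
    if i == 0 then (if j == 0 then a else b) else (if j == 0 then c else d).

Lemma det_mx2 (M : 'M[R]_2) : \det M = M 0 0 * M 1 1 - M 0 1 * M 1 0.
Proof.
have l1 : lift 0 0 = 1 :> 'I_2 by apply: val_inj.
have l0 : lift 1 0 = 0 :> 'I_2 by apply: val_inj.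
rewrite (expand_det_row _ 0) sum_I2 /cofactor !det_mx11 !mxE l1 l0 /=.
by rewrite expr0 mul1r expr1 mulN1r mulrN.
Qed.

Lemma det_mx2E a b c d : \det (mx2 a b c d) = a * d - b * c.
Proof. by rewrite det_mx2 !mxE. Qed.

Definition mkSL2 a b c d (e : a * d - b * c = 1) : SL 2 R :=
  MkSL (introT eqP (etrans (det_mx2E a b c d) e)).

Lemma SL2P A B : SLval A 0 0 = SLval B 0 0 -> SLval A 0 1 = SLval B 0 1 ->
  SLval A 1 0 = SLval B 1 0 -> SLval A 1 1 = SLval B 1 1 -> A = B.
Proof.
move=> e00 e01 e10 e11; apply/val_inj/matrixP => i j.
have I2 (k : 'I_2) : k = 0 \/ k = 1.
  by case: k => [[|[|k]] lt_k]; [left|right|]; try exact: val_inj.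
by case: (I2 i) => ->; case: (I2 j) => ->.
Qed.

Lemma SL2_det A : SLval A 0 0 * SLval A 1 1 - SLval A 0 1 * SLval A 1 0 = 1.
Proof. by rewrite -det_mx2 det_SL. Qed.

Lemma SL2_mul A B i j :
  SLval (A * B)%g i j = SLval A i 0 * SLval B 0 j + SLval A i 1 * SLval B 1 j.
Proof. by rewrite mxE sum_I2. Qed.

Lemma SL2_one : SLval (1%g : SL 2 R) = mx2 1 0 0 1.
Proof.
apply/matrixP => i j; rewrite !mxE.
by case: i j => [[|[|i]] ?] [[|[|j]] ?].
Qed.

Lemma SL2_inv A :
  SLval A^-1%g = mx2 (SLval A 1 1) (- SLval A 0 1) (- SLval A 1 0) (SLval A 0 0).
Proof.
have e : SLval A 1 1 * SLval A 0 0 - - SLval A 0 1 * - SLval A 1 0 = 1.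
  by rewrite mulrNN mulrC [SLval A 0 1 * _]mulrC -(SL2_det A); ring.
suff -> : A^-1%g = mkSL2 e by [].
apply: (@mulgI _ A); rewrite mulgV; have := SL2_det A => dA.
by apply: SL2P; rewrite SL2_mul SL2_one !mxE /= -?dA; ring.
Qed.

Definition SL2E := (SL2_mul, SL2_one, SL2_inv).

End SL2Entries.

Section ValuedField.

(* [O] is a valuation ring of [K] in which every nonzero ideal is generated by
   a power of [t^-1]. *)
Variables (K : fieldType) (O : K -> Prop) (t : K).
Hypothesis O1 : O 1.
Hypothesis OB : forall x y, O x -> O y -> O (x - y).
Hypothesis OM : forall x y, O x -> O y -> O (x * y).
Hypothesis OtV : O t^-1.
Hypothesis Ot : ~ O t.
Hypothesis Ounif : forall x, x != 0 ->
  exists k l u, [/\ O u, O u^-1 & x * t ^+ k = t ^+ l * u].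

Local Notation "M #( i , j )" := (SLval M i j)
  (at level 2, left associativity, format "M #( i ,  j )").

Definition vertex0 (M : SL 2 K) :=
  [/\ O M#(0, 0), O M#(0, 1), O M#(1, 0) & O M#(1, 1)].

(** The conjugate of SL_2(O) by [diag(t, 1)], stabiliser of a neighbour of the standard vertex. *)
Definition vertex1 (M : SL 2 K) :=
  [/\ O M#(0, 0), O (M#(0, 1) / t), O (M#(1, 0) * t) & O M#(1, 1)].

Let Bor (M : SL 2 K) : Prop := M#(1, 0) = 0.

Let O0 : O 0. Proof. by rewrite -(subrr 1); apply: OB. Qed.
Let ON x : O x -> O (- x). Proof. by rewrite -sub0r; apply: OB. Qed.
Let OD x y : O x -> O y -> O (x + y).
Proof. by move=> ? /ON ?; rewrite -[y]opprK; apply: OB. Qed.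
Let OtVX n : O (t^-1 ^+ n).
Proof. by elim: n => [|n IHn]; rewrite ?expr0 // exprS; apply: OM. Qed.
Let t_neq0 : t != 0.
Proof. by apply/eqP=> t0; apply: Ot; rewrite t0. Qed.
Let OdivM x : O (x * t) -> O x.
Proof. by move=> /OM/(_ OtV); rewrite mulfK. Qed.

(** The two sides are exclusive: [O (x * t)] puts [x] in the maximal ideal, generated by [t^-1]. *)
Let O_or_inv x : x != 0 -> O (x * t) \/ O x^-1.
Proof.
move=> x0; have [k [l [u [Ou OuV E]]]] := Ounif x0.
have tX n : t ^+ n != 0 by rewrite expf_neq0.
have x_eq : x = t ^+ l * u / t ^+ k by rewrite -E mulfK.
have [lt_lk|le_kl] := ltnP l k.
  left; rewrite (_ : x * t = t^-1 ^+ (k - l.+1) * u); first exact: OM.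
  rewrite x_eq -(subnKC lt_lk) addKn exprD exprS exprVn.
  by field; rewrite t_neq0 !tX.
right; rewrite (_ : x^-1 = t^-1 ^+ (l - k) * u^-1); first exact: OM.
by rewrite x_eq -{1}(subnK le_kl) exprD mulrAC mulfK // invfM exprVn.
Qed.

Let w : SL 2 K := @mkSL2 K 0 (- 1) 1 0 ltac:(ring).
Fact w1_det : 0 * 0 - - t * t^-1 = 1. Proof. by field. Qed.
Let w1 : SL 2 K := mkSL2 w1_det.

Let tauX n : SLval ((w1 * w^-1) ^+ n)%g = mx2 (t ^+ n) 0 0 (t^-1 ^+ n).
Proof.
elim: n => [|n IHn]; first by rewrite expg0 SL2_one !expr0.
rewrite expgS; apply/matrixP => i j; rewrite !SL2E IHn !mxE.
by case: i j => [[|[|i]] ?] [[|[|j]] ?] //=; rewrite ?exprS; ring.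
Qed.

Lemma vertex0_subgroup : subgroup_closed vertex0.
Proof.
split=> [|x y [a b c d] [a' b' c' d']|x [a b c d]].
- by rewrite /vertex0 SL2E !mxE /=; split.
- by rewrite /vertex0 !SL2E; split; apply: OD; apply: OM.
- by rewrite /vertex0 SL2E !mxE /=; split; auto.
Qed.

Lemma vertex1_subgroup : subgroup_closed vertex1.
Proof.
split=> [|x y [a b c d] [a' b' c' d']|x [a b c d]].
- by rewrite /vertex1 SL2E !mxE /= !mul0r; split.
- have E : forall p q, p * q = (p / t) * (q * t) :> K by move=> p q; field.
  rewrite /vertex1 !SL2E; split; rewrite ?mulrDl.
  + by apply: OD; [exact: OM | rewrite E; apply: OM].
  + by rewrite -mulrA mulrAC; apply: OD; apply: OM.
  + by rewrite mulrAC -[X in _ + X]mulrA; apply: OD; apply: OM.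
  + by apply: OD; [rewrite mulrC E mulrC; apply: OM | exact: OM].
- by rewrite /vertex1 SL2E !mxE /= !mulNr; split; auto.
Qed.

Lemma tree_morphism (Gamma F : groupType)
    (iota : {multiplicative Gamma -> SL 2 K}) (lam : SL 2 K -> F) :
    (forall g i, vertex0 i -> vertex1 i -> lam (g * i)%g = lam g) ->
    (forall c g, lam (iota c * g)%g = lam g) ->
  exists theta : {multiplicative Gamma -> F},
  forall c u v, vertex0 u -> vertex0 v -> vertex1 (v^-1 * iota c * u)%g ->
    theta c = (lam v * (lam u)^-1)%g.
Proof.
move=> lam_Iw lam_iota; apply: (@tree_action_morphism (SL 2 K) F Bor
  vertex0 vertex1 w w1 _ _ _ _ _ _ _ _ _ _ _ _ _ _ lam lam_Iw _ iota lam_iota).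
- split=> [|x y|x]; rewrite /Bor !SL2E ?mxE //=; last by move=> ->; rewrite oppr0.
  by move=> -> ->; rewrite mulr0 mul0r addr0.
- exact: vertex0_subgroup.
- exact: vertex1_subgroup.
- by rewrite /vertex0 !mxE /=; split; auto.
- by rewrite /vertex1 !mxE /= mulNr mulVf // mulfV //; split; auto.
- by rewrite /Bor !SL2E !mxE /=; ring.
(* Iwasawa decomposition. [g * p^-1] is upper triangular when [p] has bottom row proportional to
   that of [g]; the row is scaled to [(1, 0)], [(r, 1)] or [(1, r^-1)], whichever is integral. *)
- move=> g; have [g10|g10] := eqVneq g#(1, 0) 0.
    exists g, 1%g; rewrite mulg1; split=> //.
    by case: vertex0_subgroup.
  suff [p [Bp Pp]] : exists p, Bor (g * p^-1)%g /\ vertex0 p.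
    by exists (g * p^-1)%g, p; rewrite mulgVK.
  have [d0|d0] := eqVneq g#(1, 1) 0.
    exists w; rewrite /Bor /vertex0 !SL2E d0 !mxE /=; split; first by ring.
    by split; auto.
  have r0 : g#(1, 0) / g#(1, 1) != 0 by rewrite mulf_neq0 ?invr_neq0.
  have [/OdivM Or|Or] := O_or_inv r0.
    have e : 1 * 1 - 0 * (g#(1, 0) / g#(1, 1)) = 1 by ring.
    exists (mkSL2 e); rewrite /Bor /vertex0 !SL2E !mxE /=; split; first by field.
    by split.
  have e : 0 * (g#(1, 1) / g#(1, 0)) - -1 * 1 = 1 by ring.
  rewrite invf_div in Or; exists (mkSL2 e); rewrite /Bor /vertex0 !SL2E !mxE /=.
  by split; [field | split; auto].
- by move=> b b10 [? ? ? ?]; split; rewrite ?b10 ?mul0r; auto.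
(* Bruhat decomposition over the residue field: the lower left entry is in the maximal ideal, or it
   is a unit and an upper unipotent clears the entry above it. *)
- move=> p Pp; have [c0|c0] := eqVneq p#(1, 0) 0.
    by left; case: Pp; split=> //; split; rewrite ?c0 ?mul0r; auto.
  have [Oct|OcV] := O_or_inv c0.
    by left; case: Pp; split=> //; split; rewrite // ?c0 ?mul0r; auto.
  right; case: Pp => Oa Ob Oc Od.
  have e : 1 * 1 - p#(0, 0) / p#(1, 0) * 0 = 1 by ring.
  exists (mkSL2 e), (w^-1 * (mkSL2 e)^-1 * p)%g; split.
  + by rewrite /Bor mxE.
  + by rewrite /vertex0 !mxE /=; split; auto.
  + have i00 : (w^-1 * (mkSL2 e)^-1 * p)%g#(0, 0) = p#(1, 0).
      by rewrite !SL2E !mxE /=; ring.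
    have i01 : (w^-1 * (mkSL2 e)^-1 * p)%g#(0, 1) = p#(1, 1).
      by rewrite !SL2E !mxE /=; ring.
    have i10 : (w^-1 * (mkSL2 e)^-1 * p)%g#(1, 0) = 0.
      by rewrite !SL2E !mxE /=; field.
    have i11 : (w^-1 * (mkSL2 e)^-1 * p)%g#(1, 1) =
        p#(0, 0) * p#(1, 0)^-1 * p#(1, 1) - p#(0, 1).
      by rewrite !SL2E !mxE /=; ring.
    rewrite /vertex0 /vertex1 i00 i01 i10 i11.
    by split; split; rewrite ?mul0r; auto.
  + by rewrite !mulgA mulgK mulgV mul1g.
(* The same dichotomy at the second vertex, now on the lower right entry: in the maximal ideal or a
   unit. *)
- move=> p [Oa Ob Oc Od].
  have Oc' := OdivM Oc.
  have [Odt|[d0 OdV]] : O (p#(1, 1) * t) \/ p#(1, 1) != 0 /\ O p#(1, 1)^-1.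
    have [->|d0] := eqVneq p#(1, 1) 0; first by left; rewrite mul0r.
    by case: (O_or_inv d0); auto.
  + exists (w1^-1 * p)%g; split; last by left; rewrite mulVKg.
    rewrite /vertex0 /vertex1 !SL2E !mxE /= !mul0r !add0r !addr0 opprK.
    rewrite ![t * _]mulrC !mulNr ![t^-1 * _]mulrC mulfK // mulfVK //.
    by split; split; auto.
  + have e : 1 * 1 - p#(0, 1) / p#(1, 1) * 0 = 1 by ring.
    exists ((mkSL2 e)^-1 * p)%g; split; last first.
      right; exists (mkSL2 e); rewrite mulVKg /Bor /vertex1 !mxE /= mul0r.
      by split=> //; split=> //; rewrite mulrAC; apply: OM.
    have i01 : ((mkSL2 e)^-1 * p)%g#(0, 1) = 0.
      by rewrite !SL2E !mxE /=; field.
    have i00 : ((mkSL2 e)^-1 * p)%g#(0, 0) =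
        p#(0, 0) - p#(0, 1) / t * (p#(1, 0) * t) * p#(1, 1)^-1.
      by rewrite !SL2E !mxE /=; field; rewrite d0 t_neq0.
    have i10 : ((mkSL2 e)^-1 * p)%g#(1, 0) = p#(1, 0).
      by rewrite !SL2E !mxE /=; ring.
    have i11 : ((mkSL2 e)^-1 * p)%g#(1, 1) = p#(1, 1).
      by rewrite !SL2E !mxE /=; ring.
    rewrite /vertex0 /vertex1 i00 i01 i10 i11 mul0r.
    by split; split; auto.
- move=> b b10 [Oa Ob Oc Od].
  have E : SLval (b ^ (w1 * w^-1))%g = mx2 b#(0, 0) (b#(0, 1) / t / t) 0 b#(1, 1).
    apply/matrixP => i j; rewrite conjgE !SL2E b10 !mxE.
    by case: i j => [[|[|i]] ?] [[|[|j]] ?] //=; field.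
  by rewrite /vertex0 E !mxE /=; split; auto.
- move=> b b10 [Oa Ob Oc Od].
  have E : SLval (b ^ w1)%g = mx2 b#(1, 1) 0 (- (b#(0, 1) / t / t)) b#(0, 0).
    apply/matrixP => i j; rewrite conjgE !SL2E b10 !mxE.
    by case: i j => [[|[|i]] ?] [[|[|j]] ?] //=; field.
  rewrite /vertex0 /vertex1 E !mxE /= mul0r mulNr mulfVK //.
  by split; split; auto.
- move=> b b10; have := SL2_det b; rewrite b10 mulr0 subr0 => ad1.
  have a0 : b#(0, 0) != 0.
    by apply: contraNneq (oner_neq0 K) => a0; rewrite -ad1 a0 mul0r.
  have [k [l [u [Ou OuV Ea]]]] := Ounif a0.
  (* The diagonal of [b] fixes [l - k]. Adding [m] steps on both sides makes the upper right entry
     of [c] equal to [b01 * t^-(k+l+2m)], which is integral for this [m]. *)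
  have [m Om] : exists m, O (b#(0, 1) * t^-1 ^+ m).
    have [->|b0] := eqVneq b#(0, 1) 0; first by exists 0%N; rewrite mul0r.
    have [k' [m [v [Ov _ Eb]]]] := Ounif b0; exists m.
    rewrite (_ : _ * _ = t^-1 ^+ k' * v); first exact: OM.
    have tX n : t ^+ n != 0 by rewrite expf_neq0.
    by apply: (mulIf (tX k')); rewrite mulrAC Eb !exprVn; field; rewrite !tX.
  have tX n : t ^+ n != 0 by rewrite expf_neq0.
  have u0 : u != 0.
    by apply: contraNneq (mulf_neq0 a0 (tX k)) => u0; rewrite Ea u0 mulr0.
  have e : u * u^-1 - b#(0, 1) * t^-1 ^+ m * t^-1 ^+ (k + l + m) * 0 = 1 by field.
  have aE : b#(0, 0) = t ^+ l * u / t ^+ k by rewrite -Ea mulfK.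
  have dE : b#(1, 1) = t ^+ k / (t ^+ l * u).
    by apply: (mulfI a0); rewrite ad1 aE; field; rewrite u0 !tX.
  exists (k + m)%N, (l + m)%N, (mkSL2 e); split.
  + by rewrite /Bor mxE.
  + by rewrite /vertex0 !mxE /=; split; auto.
  apply: SL2P; rewrite !SL2_mul !tauX !mxE /= ?b10 ?aE ?dE ?exprVn ?exprD;
  by field; rewrite ?u0 ?t_neq0 ?tX.
- move=> n; rewrite /vertex0 tauX !mxE /= => -[Otn _ _ _]; apply: Ot.
  rewrite (_ : t = t ^+ n.+1 * t^-1 ^+ n); first exact: OM.
  by rewrite exprVn exprS mulfK ?expf_neq0.
Qed.

End ValuedField.

(** * The action of SL_2 over the conic ring *)

Section MapSL2.

Variables (R S : comNzRingType) (f : {rmorphism R -> S}).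

Fact SL_map_subproof n (A : SL n R) : \det (map_mx f A) == 1.
Proof. by rewrite det_map_mx det_SL rmorph1. Qed.

Definition SL_map n (A : SL n R) : SL n S := MkSL (SL_map_subproof A).

Fact SL_mapM n : {morph @SL_map n : A B / (A * B)%g >-> (A * B)%g}.
Proof. by move=> A B; apply/val_inj; rewrite /= map_mxM. Qed.

HB.instance Definition _ n :=
  isMultiplicative.Build (SL n R) (SL n S) (@SL_map n) (@SL_mapM n).

End MapSL2.

Definition conic_pi : {rmorphism {mpoly rat[2]} -> conic_ring} :=
  \pi_({ideal_quot conic_idealr})%qT.

(** * Evaluation of the conic ring at a point of the conic *)

Section ConicMorphism.

Variables (S : comNzRingType) (rho : {rmorphism rat -> S}) (a b : S).
Hypothesis ab_conic : a ^+ 2 + b ^+ 2 + 1 = 0.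

Definition conic_point (i : 'I_2) := if i == ord0 then a else b.

Definition conic_eval (f : conic_ring) : S :=
  mmap rho conic_point (generic_quotient.repr f).

Lemma conic_eval_pi p : conic_eval (conic_pi p) = mmap rho conic_point p.
Proof.
apply/eqP; rewrite -subr_eq0 -rmorphB.
have /conic_idealP[q ->] :
    generic_quotient.repr (conic_pi p) - p \in (conic_idealr : {pred _}).
  by rewrite Quotient.idealrBE; apply/eqP; apply: reprK.
 rewrite rmorphM /conic_poly !rmorphD rmorph1.
by rewrite !rmorphXn /= !mmapX !mmap1U /conic_point /= ab_conic mulr0.
Qed.

Lemma conic_eval_x : conic_eval (conic_pi 'X_ord0) = a.
Proof. by rewrite conic_eval_pi mmapX mmap1U. Qed.

Lemma conic_eval_y : conic_eval (conic_pi 'X_ord_max) = b.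
Proof. by rewrite conic_eval_pi mmapX mmap1U. Qed.

Lemma conic_eval_const r : conic_eval (conic_pi r%:MP) = rho r.
Proof. by rewrite conic_eval_pi mmapC. Qed.

Lemma conic_ringP (f : conic_ring) : exists p, f = conic_pi p.
Proof. by exists (generic_quotient.repr f); apply/esym/reprK. Qed.

Fact conic_eval_zmod : zmod_morphism conic_eval.
Proof.
move=> f g; have [p ->] := conic_ringP f; have [q ->] := conic_ringP g.
by rewrite -rmorphB !conic_eval_pi rmorphB.
Qed.

Fact conic_eval_monoid : monoid_morphism conic_eval.
Proof.
split=> [|f g]; first by rewrite -(rmorph1 conic_pi) conic_eval_pi rmorph1.
have [p ->] := conic_ringP f; have [q ->] := conic_ringP g.
by rewrite -rmorphM !conic_eval_pi rmorphM.
Qed.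

HB.instance Definition _ :=
  GRing.isZmodMorphism.Build conic_ring S conic_eval conic_eval_zmod.
HB.instance Definition _ :=
  GRing.isMonoidMorphism.Build conic_ring S conic_eval conic_eval_monoid.

Definition conic_morphism : {rmorphism conic_ring -> S} := conic_eval.

(* Reducing modulo [y^2 = - 1 - x^2] leaves polynomials of degree at most one
   in [y]. *)
Lemma conic_eval_affine f : exists A B : {poly rat},
  conic_eval f = (map_poly rho A).[a] + (map_poly rho B).[a] * b.
Proof.
have [p ->] := conic_ringP f; rewrite conic_eval_pi.
pose aff z := exists A B : {poly rat},
  z = (map_poly rho A).[a] + (map_poly rho B).[a] * b.
have affC c : aff (rho c).
  by exists c%:P, 0; rewrite map_polyC rmorph0 !hornerE.
have affa : aff a by exists 'X, 0; rewrite map_polyX rmorph0 !hornerE.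
have affb : aff b by exists 0, 1; rewrite rmorph0 rmorph1 !hornerE.
have affM u v : aff u -> aff v -> aff (u * v).
  move=> [A [B ->]] [A' [B' ->]].
  exists (A * A' - B * B' * ('X ^+ 2 + 1)), (A * B' + B * A').
  have bb : b ^+ 2 = - (a ^+ 2 + 1).
    by apply/eqP; rewrite -addr_eq0 addrCA addrA ab_conic.
  rewrite rmorphB !rmorphD !rmorphM rmorphD rmorphXn rmorph1 /= map_polyX !hornerE.
  set A1 := (map_poly rho A).[a]; set B1 := (map_poly rho B).[a].
  set A2 := (map_poly rho A').[a]; set B2 := (map_poly rho B').[a].
  transitivity (A1 * A2 + (A1 * B2 + B1 * A2) * b + B1 * B2 * b ^+ 2); first by ring.
  by rewrite bb; ring.
rewrite /mmap; elim/big_rec: _ => [|m z _ [A [B ->]]].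
  by exists 0, 0; rewrite rmorph0 !hornerE.
suff [A' [B' ->]] : aff (rho p@_m * mmap1 conic_point m).
  by exists (A' + A), (B' + B); rewrite !rmorphD /= !hornerD; ring.
apply: (affM) => //; rewrite /mmap1; elim/big_rec: _ => [|i u _ affu].
  by rewrite -(rmorph1 rho).
apply: (affM) => //; elim: (m i) => [|n IHn]; first by rewrite expr0 -(rmorph1 rho).
by rewrite exprS; apply: (affM) => //; rewrite /conic_point; case: ifP.
Qed.

End ConicMorphism.

(** * Edge orbits and their labels under SL_2 of the conic ring *)

Section ConicTree.

Variables (K : fieldType) (O : K -> Prop) (t : K) (kap : {rmorphism algC -> K}).
Hypothesis OB : forall x y, O x -> O y -> O (x - y).
Hypothesis OM : forall x y, O x -> O y -> O (x * y).
Hypothesis OtV : O t^-1.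
Hypothesis Ounif : forall x, x != 0 ->
  exists k l u, [/\ O u, O u^-1 & x * t ^+ k = t ^+ l * u].
Hypothesis Okap : forall c, O (kap c).
Hypothesis Okap_t : forall c, O (kap c * t) -> c = 0.

Let O1 : O 1. Proof. by rewrite -(rmorph1 kap). Qed.
Let O0 : O 0. Proof. by rewrite -(rmorph0 kap). Qed.
Let ON x : O x -> O (- x). Proof. by rewrite -sub0r; apply: OB. Qed.
Let OD x y : O x -> O y -> O (x + y).
Proof. by move=> ? /ON ?; rewrite -[y]opprK; apply: OB. Qed.
Let OtVX n : O (t^-1 ^+ n).
Proof. by elim: n => [|n IHn]; rewrite ?expr0 // exprS; apply: OM. Qed.
Let Ot : ~ O t.
Proof.
rewrite -[t]mul1r -(rmorph1 kap) => /Okap_t/eqP.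
by rewrite oner_eq0.
Qed.
Let t_neq0 : t != 0.
Proof. by apply/eqP=> t0; apply: Ot; rewrite t0. Qed.
Let two_neq0 : 2 != 0 :> K.
Proof. by rewrite -(rmorph_nat kap) fmorph_eq0 pnatr_eq0. Qed.

Let I := kap 'i.
Let II : I * I = - 1. Proof. by rewrite -rmorphM -expr2 sqrCi rmorphN1. Qed.
Let x := (t - t^-1) / 2.
Let y := - I * (x + t^-1).
Let rho : {rmorphism rat -> K} := kap \o ratr.

Let xy_conic : x ^+ 2 + y ^+ 2 + 1 = 0.
Proof.
have -> : y ^+ 2 = - (x + t^-1) ^+ 2 by rewrite /y exprMn sqrrN expr2 II mulN1r.
rewrite /x; by field; rewrite t_neq0 two_neq0.
Qed.

Let Ohalf : O 2^-1.
Proof. by rewrite -(rmorph_nat kap) -fmorphV. Qed.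

Let Orho r : O (rho r). Proof. exact: Okap. Qed.

Ltac integrality := repeat first
  [assumption | exact: OtVX | exact: Okap | exact: Orho
  | apply: OM | apply: OB | apply: OD | apply: ON].

(** [x / t] is 1/2 up to the maximal ideal, so only the coefficient of degree [n] survives, divided
    by [2^n]. *)
Lemma horner_lead (A : {poly rat}) n : (size A <= n.+1)%N ->
  exists2 e, O e &
    (map_poly rho A).[x] * t^-1 ^+ n = kap (ratr A`_n / 2 ^+ n) + t^-1 * e.
Proof.
elim/poly_ind: A n => [|A c IHA] n.
  by exists 0; rewrite // rmorph0 horner0 coef0 rmorph0 !mul0r rmorph0 mulr0 addr0.
rewrite size_MXaddC rmorphD rmorphM /= map_polyX map_polyC hornerMXaddC.
rewrite coefD coefMX coefC /=.
case: n => [|n] sA.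
  have -> : A = 0.
    apply/eqP; rewrite -size_poly_leq0; move: sA; case: ifP => // /andP[/eqP->].
    by rewrite size_poly0.
  by exists 0; rewrite // rmorph0 horner0 mul0r !add0r !expr0 mulr1 divr1 mulr0 addr0.
have [|e Oe E] := IHA n.
  by move: sA; case: ifP => // /andP[/eqP->]; rewrite size_poly0.
have xtE : x * t^-1 = 2^-1 - t^-1 * (t^-1 * 2^-1).
  by rewrite /x; field; rewrite two_neq0 t_neq0.
exists (e * 2^-1 - (kap (ratr A`_n / 2 ^+ n) + t^-1 * e) * (t^-1 * 2^-1)
  + rho c * t^-1 ^+ n).
  integrality.
rewrite addr0 mulrDl !exprS.
rewrite (_ : _ * x * _ = (map_poly rho A).[x] * t^-1 ^+ n * (x * t^-1)).
  rewrite E xtE (_ : ratr A`_n / (2 * 2 ^+ n) = ratr A`_n / 2 ^+ n / 2).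
    by rewrite [kap (_ / 2)]rmorphM fmorphV rmorph_nat; ring.
  by rewrite invfM mulrA mulrAC.
by ring.
Qed.

(* Write the value as [A(x) + B(x) y].  As [y] is [- i x] up to an infinitesimal,
   its pole of order [n] has leading coefficient [a_n - i b_(n-1)], and rational
   [a_n] and [b_(n-1)] cannot cancel. *)
Lemma conic_eval_integral (f : conic_ring) :
  O (conic_eval rho x y f) -> exists r, conic_eval rho x y f = rho r.
Proof.
have [A [B ->]] := conic_eval_affine rho xy_conic f => Of.
(* The least [n] with [deg A <= n] and [deg B <= n - 1]. If it is positive, the vanishing of both
   leading coefficients below contradicts minimality. *)
pose n := maxn (size A).-1 (size B).
have sA : (size A <= n.+1)%N by apply: leq_trans (leqSpred _) _; rewrite ltnS leq_maxl.
have sB : (size B <= n)%N by rewrite leq_maxr.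
case En : n sA sB => [|m] sA sB.
  have -> : B = 0 by apply/eqP; rewrite -size_poly_leq0.
  exists A`_0; rewrite rmorph0 horner0 mul0r addr0 (size1_polyC sA).
  by rewrite map_polyC hornerC coefC.
have [e Oe EA] := horner_lead sA; have [e' Oe' EB] := horner_lead sB.
have ytE : y * t^-1 = - I * 2^-1 - t^-1 * (I * (t^-1 * 2^-1)).
  by rewrite /y /x; field; rewrite two_neq0 t_neq0.
pose a := ratr A`_m.+1 / 2 ^+ m.+1 : algC; pose b := ratr B`_m / 2 ^+ m.+1 : algC.
have ab0 : a - 'i * b = 0.
  apply: Okap_t; set f0 := _ + _ in Of.
  have E : f0 * t^-1 ^+ m.+1 = kap a + t^-1 * e
      + (kap (ratr B`_m / 2 ^+ m) + t^-1 * e') * (y * t^-1).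
    by rewrite -EA -EB /f0 !exprS; ring.
  rewrite (_ : _ * t = f0 * t^-1 ^+ m - e
    + (kap (ratr B`_m / 2 ^+ m) + t^-1 * e') * (I * (t^-1 * 2^-1))
    + e' * I * 2^-1); first integrality.
  have -> : f0 * t^-1 ^+ m = f0 * t^-1 ^+ m.+1 * t.
    by rewrite exprSr mulrA mulfVK.
  rewrite E ytE (_ : ratr B`_m / 2 ^+ m = 2 * b).
    rewrite rmorphB [kap ('i * b)]rmorphM [kap (2 * b)]rmorphM rmorph_nat /= -/I.
    by field; rewrite t_neq0 two_neq0.
  by rewrite /b exprS; field; rewrite ?expf_neq0 ?pnatr_eq0.
have {ab0} [a0 b0] : a = 0 /\ b = 0.
  have rr (r : rat) k : ratr r / 2 ^+ k \is @Num.real algC.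
    by rewrite rpred_div ?rpredX ?rpred_nat // Creal_Crat ?Crat_rat.
  have Nb : - b \is Num.real by rewrite rpredN rr.
  have := Im_rect (rr A`_m.+1 m.+1) Nb; have := Re_rect (rr A`_m.+1 m.+1) Nb.
  rewrite mulrN ab0 raddf0 raddf0 => a0 /esym/eqP; rewrite oppr_eq0 => /eqP b0.
  by split; first exact: esym.
have ratr0 (r : rat) k : ratr r / 2 ^+ k = 0 :> algC -> r = 0.
  move/eqP; rewrite mulf_eq0 invr_eq0 fmorph_eq0 expf_eq0 pnatr_eq0 andbF orbF.
  by move/eqP.
have sA1 : (size A <= m.+1)%N.
  rewrite leqNgt; apply/negP => gtA; have EsA : size A = m.+2.
    by apply/eqP; rewrite eqn_leq sA.
  have : lead_coef A == 0 by rewrite lead_coefE EsA /= (ratr0 _ _ a0).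
  by rewrite lead_coef_eq0 -size_poly_eq0 EsA.
have sB1 : (size B <= m)%N.
  rewrite leqNgt; apply/negP => gtB; have EsB : size B = m.+1.
    by apply/eqP; rewrite eqn_leq sB.
  have : lead_coef B == 0 by rewrite lead_coefE EsB /= (ratr0 _ _ b0).
  by rewrite lead_coef_eq0 -size_poly_eq0 EsB.
suff : (n <= m)%N by rewrite En ltnn.
by rewrite geq_max sB1 andbT -ltnS; case: (size A) sA1 => //= k; rewrite ltnS.
Qed.

Let ev : {rmorphism conic_ring -> K} := conic_morphism rho xy_conic.

Let iota : {multiplicative SL 2 conic_ring -> SL 2 K} := @SL_map _ _ ev 2.

Fact edge_det r : I * rho r * 0 - -1 * 1 = 1.
Proof. by rewrite mulr0 mulN1r opprK add0r. Qed.

(* Carries the standard edge to the edge issuing from the standard vertex in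
   the direction [r * 'i] of the projective line over the residue field. *)
Definition edge r : SL 2 K := mkSL2 (edge_det r).

Local Notation vertex0 := (vertex0 O).
Local Notation vertex1 := (vertex1 O t).

Lemma edge_vertex0 r : vertex0 (edge r).
Proof. by rewrite /vertex0 !mxE /=; split; integrality. Qed.

(** [iota g] fixes the standard vertex, so it is a rational matrix [[p, q; r, s]]. Sending the
    direction [a i] to [b i] means [b s = a p] and [q = - a b r], and then [a b = a b (p s - q r) =
    (a p)^2 + (a b r)^2]. *)
Lemma edge_orbit g a b :
    vertex0 ((edge b)^-1 * iota g * edge a)%g ->
    vertex1 ((edge b)^-1 * iota g * edge a)%g ->
  sum_of_two_squares (a * b).
Proof.
have [_ V0M V0V] := vertex0_subgroup O1 OB OM.
move=> V0h V1h; have : vertex0 (iota g).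
  rewrite (_ : iota g = edge b * ((edge b)^-1 * iota g * edge a) * (edge a)^-1)%g.
    by apply: (V0M); [apply: (V0M) | apply: V0V] => //; apply: edge_vertex0.
  by rewrite !mulgA mulgV mul1g mulgK.
case; rewrite /= !mxE => /conic_eval_integral[p Ep] /conic_eval_integral[q Eq].
move=> /conic_eval_integral[r Er] /conic_eval_integral[s Es].
have det1 : p * s - q * r = 1.
  apply: (fmorph_inj rho); rewrite rmorphB !rmorphM rmorph1 -Ep -Eq -Er -Es.
  by have := SL2_det (iota g); rewrite /= !mxE.
case: V1h => _ _ + _; rewrite !SL2E !mxE /= /ev /= Ep Eq Er Es.
have rhoM u v : rho (u * v) = rho u * rho v by exact: rmorphM.
have rhoD u v : rho (u + v) = rho u + rho v by exact: rmorphD.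
have rhoB u v : rho (u - v) = rho u - rho v by exact: rmorphB.
have kapE u v : kap (- ratr u + 'i * ratr v) = - rho u + I * rho v.
  by rewrite rmorphD rmorphN [kap ('i * _)]rmorphM.
rewrite (_ : _ * t = kap (- ratr (a * b * r + q) + 'i * ratr (b * s - a * p)) * t).
  have rr (u : rat) : ratr u \is @Num.real algC by rewrite Creal_Crat ?Crat_rat.
  move=> /Okap_t h; have Nr := rr (a * b * r + q); rewrite -rpredN in Nr.
  have := Re_rect Nr (rr (b * s - a * p)); have := Im_rect Nr (rr (b * s - a * p)).
  rewrite h !raddf0 => /esym/eqP; rewrite fmorph_eq0 subr_eq0 => /eqP bs.
  move=> /esym/eqP; rewrite oppr_eq0 fmorph_eq0 addrC addr_eq0 => /eqP qE.
  exists (a * p), (a * b * r); rewrite -[LHS]mulr1 -det1 mulrBr.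
  rewrite (_ : a * b * (p * s) = a * p * (b * s)); last by ring.
  by rewrite bs qE; ring.
rewrite kapE rhoB rhoD !rhoM; congr (_ * _).
transitivity (- (rho p * (I * rho a)) - rho q + I * rho b * rho s
   + I * I * rho b * rho r * rho a); first by ring.
by rewrite II; ring.
Qed.

Let sub0 : subgroup_closed vertex0. Proof. exact: vertex0_subgroup. Qed.
Let sub1 : subgroup_closed vertex1. Proof. exact: vertex1_subgroup. Qed.

Let gen k : F_omega := free_gen k.

Let orbit (M : SL 2 K) k := exists g i,
  [/\ vertex0 i, vertex1 i & M = (iota g * edge (radicand k)%:R * i)%g].

(** The orbits prove disjoint, so the chosen index is the only one. The inverse makes [link k] map
    to the generator itself. *)
Definition edge_label (M : SL 2 K) : F_omega :=
  if excluded_middle_informative (exists k, orbit M k) is left ex_k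
  then ((gen (proj1_sig (constructive_indefinite_description _ ex_k)))^-1)%g
  else 1%g.

Let orbit_uniq M j k : orbit M j -> orbit M k -> j = k.
Proof.
have [[_ V0M V0V] [_ V1M V1V]] := (sub0, sub1).
move=> [g [i [V0i V1i ->]]] [g' [i' [V0i' V1i' E]]].
apply: radicand_mul_not_sum; rewrite natrM.
have iotaE : (iota g' * iota (g'^-1 * g) = iota g)%g by rewrite -gmulfM mulVKg.
have Eh : ((edge (radicand k)%:R)^-1 * iota (g'^-1 * g) * edge (radicand j)%:R
    = i' * i^-1)%g.
  apply: (@mulgI _ (iota g' * edge (radicand k)%:R)%g); apply: (@mulIg _ i).
  by rewrite !mulgA mulgVK -E mulgK iotaE.
apply: (@edge_orbit (g'^-1 * g)%g); rewrite Eh.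
  by apply: (V0M) => //; apply: V0V.
by apply: (V1M) => //; apply: V1V.
Qed.

Let edge_label_orbit M k : orbit M k -> edge_label M = (gen k)^-1%g.
Proof.
move=> Mk; rewrite /edge_label.
case: excluded_middle_informative => [ex_k|[]]; last by exists k.
by case: constructive_indefinite_description => j /= /orbit_uniq/(_ Mk)->.
Qed.

Let edge_label_none M : (forall k, ~ orbit M k) -> edge_label M = 1%g.
Proof.
move=> no_k; rewrite /edge_label; case: excluded_middle_informative => // ex_k.
by have [k /no_k] := ex_k.
Qed.

Let edge_label_eq M N : (forall k, orbit M k <-> orbit N k) ->
  edge_label M = edge_label N.
Proof.
move=> MN; have [[k Mk]|no_k] := excluded_middle_informative (exists k, orbit M k).
  by rewrite !(@edge_label_orbit _ k) -?MN.
by rewrite !edge_label_none // => k; rewrite -?MN => Mk; apply: no_k; exists k.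
Qed.

Let edge_label_Iw M i : vertex0 i -> vertex1 i ->
  edge_label (M * i)%g = edge_label M.
Proof.
have [[_ V0M V0V] [_ V1M V1V]] := (sub0, sub1).
move=> V0i V1i; apply: edge_label_eq => k; split=> -[g [i' [V0i' V1i' E]]].
  exists g, (i' * i^-1)%g; split; [|by apply: (V1M) => //; apply: V1V|].
    by apply: (V0M) => //; apply: V0V.
  by rewrite mulgA -E mulgK.
exists g, (i' * i)%g; split; [exact: V0M | exact: V1M |].
by rewrite mulgA E.
Qed.

Let edge_label_iota c M : edge_label (iota c * M)%g = edge_label M.
Proof.
apply: edge_label_eq => k; split=> -[g [i [V0i V1i E]]].
  exists (c^-1 * g)%g, i; split=> //; apply: (@mulgI _ (iota c)).
  by rewrite E !mulgA -gmulfM mulVKg.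
by exists (c * g)%g, i; split=> //; rewrite E !mulgA gmulfM.
Qed.

Let edge_label_one : edge_label (edge 1) = 1%g.
Proof.
apply: edge_label_none => k [g [i [V0i V1i E]]].
apply: (@radicand_not_sum k); rewrite -[X in sum_of_two_squares X]mulr1.
have Eh : ((edge 1)^-1 * iota g * edge (radicand k)%:R = i^-1)%g.
  by apply: (@mulIg _ i); rewrite mulVg -!mulgA [(iota g * _)%g]mulgA -E mulVg.
have [[_ _ V0V] [_ _ V1V]] := (sub0, sub1).
by apply: (@edge_orbit g); rewrite Eh; [apply: V0V | apply: V1V].
Qed.

Let edge_label_radicand k : edge_label (edge (radicand k)%:R) = (gen k)^-1%g.
Proof.
apply: edge_label_orbit; exists 1%g, 1%g; have [[? _ _] [? _ _]] := (sub0, sub1).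
split=> //; rewrite mulg1; suff -> : iota 1%g = 1%g by rewrite mul1g.
by apply: (@mulgI _ (iota 1%g)); rewrite -gmulfM !mulg1.
Qed.

Let cst (r : rat) : conic_ring := conic_pi r%:MP.
Let X : conic_ring := conic_pi 'X_ord0.
Let Y : conic_ring := conic_pi 'X_ord_max.

Let XY : X ^+ 2 + Y ^+ 2 = -1.
Proof.
apply/eqP; rewrite -addr_eq0 -[1](rmorph1 conic_pi) -!rmorphXn -!rmorphD /=.
rewrite -(rmorph0 conic_pi); apply/eqP/eqP; rewrite -Quotient.idealrBE subr0.
by apply/conic_idealP; exists 1; rewrite mul1r.
Qed.

Fact link_det k : let P := radicand_prod k in let c := (radicand k)%:R^-1 in
  (cst P%:R + X) * cst c * (cst P%:R - X) - (Y - 1) * ((Y + 1) * cst c) = 1.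
Proof.
move=> P c.
have cE : cst c * (cst P%:R ^+ 2 + 2) = 1.
  have cstM : {morph cst : u v / u * v} by move=> u v; rewrite /cst mpolyCM rmorphM.
  have cstD : {morph cst : u v / u + v} by move=> u v; rewrite /cst mpolyCD rmorphD.
  have cst1 : cst 1 = 1 by rewrite /cst rmorph1.
  rewrite -cst1 -[X in _ + X]/(cst 1 + cst 1).
  rewrite expr2 -cstM -!cstD -cstM -[1 + 1]/(2%:R) -natrM -natrD mulnn.
  by rewrite mulVf // pnatr_eq0 -lt0n radicand_gt0.
transitivity (cst c * (cst P%:R ^+ 2 + 1 - (X ^+ 2 + Y ^+ 2))); first by ring.
by rewrite XY -[RHS]cE; ring.
Qed.

(* [1, i, j, ij] with [i = [0, -1; 1, 0]] and [j = [x, y; y, -x]] span a copy of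
   Hamilton's quaternions in the 2 x 2 matrices over the conic ring, and the
   quaternions of norm one form the stabiliser of the vertex at the end of
   [edge 1].  The matrix below is the quaternion [P + i + j], of norm
   [P ^ 2 + 2], times [diag (1 / (P ^ 2 + 2), 1)], which moves the end of
   [edge (P ^ 2 + 2)] to the end of [edge 1]. *)
Definition link k : SL 2 conic_ring := mkSL2 (link_det k).

(** The identity [I * y = x + t^-1] cancels the poles on the diagonal and leaves [2 * I * t^-1] at
    the lower left; the simple pole remaining at the upper right is allowed by [vertex1]. *)
Lemma link_vertex1 k :
  vertex1 ((edge 1)^-1 * iota (link k) * edge (radicand k)%:R)%g.
Proof.
have evX : ev X = x by exact: conic_eval_x.
have evY : ev Y = y by exact: conic_eval_y.
have ev_cst r : ev (cst r) = rho r by exact: conic_eval_const.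
have rho1 : kap (ratr 1) = 1 by rewrite -(rmorph1 rho).
have rhoV : rho (radicand k)%:R^-1 = (rho (radicand k)%:R)^-1 by exact: fmorphV.
have c_neq0 : rho (radicand k)%:R != 0.
  by rewrite fmorph_eq0 pnatr_eq0 -lt0n radicand_gt0.
set c := rho (radicand k)%:R in rhoV c_neq0 *; set P := rho (radicand_prod k)%:R.
have E00 : SLval (iota (link k)) 0 0 = (P + x) / c.
  by rewrite !mxE /= -/(ev _) rmorphM rmorphD evX !ev_cst rhoV.
have E01 : SLval (iota (link k)) 0 1 = y - 1.
  by rewrite !mxE /= -/(ev _) rmorphB evY rmorph1.
have E10 : SLval (iota (link k)) 1 0 = (y + 1) / c.
  by rewrite !mxE /= -/(ev _) rmorphM rmorphD evY rmorph1 ev_cst rhoV.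
have E11 : SLval (iota (link k)) 1 1 = P - x.
  by rewrite !mxE /= -/(ev _) rmorphB evX ev_cst.
have Iy : I * y = x + t^-1 by rewrite /y mulrA mulrN II opprK mul1r.
have OcV : O c^-1 by rewrite -rhoV.
have OxV : O (x * t^-1).
  rewrite (_ : x * t^-1 = 2^-1 - t^-1 * (t^-1 * 2^-1)); first integrality.
  by rewrite /x; field; rewrite two_neq0 t_neq0.
have OyV : O (y * t^-1).
  rewrite (_ : y * t^-1 = - I * (x * t^-1 + t^-1 * t^-1)); first integrality.
  by rewrite /y; ring.
have OP : O P by exact: Orho.
rewrite /vertex1 !SL2E E00 E01 E10 E11 !mxE /= rho1 -[kap (ratr (radicand k)%:R)]/c.
clearbody c P; split.
- rewrite (_ : _ + _ = I * y + I + P - x); last by field; rewrite ?t_neq0 ?c_neq0.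
  by rewrite Iy (_ : _ - x = t^-1 + I + P); [integrality | ring].
- rewrite (_ : _ / t = - (y * t^-1 + t^-1) * c^-1);
    last by field; rewrite ?t_neq0 ?c_neq0.
  integrality.
- rewrite (_ : _ * t = (I * I * (y + 1) + 1 - y - 2 * I * x) * t);
    last by field; rewrite ?t_neq0 ?c_neq0.
  rewrite II (_ : _ * t = 2 * I).
    by rewrite -(rmorph_nat kap); integrality.
  by rewrite /y; field; rewrite ?t_neq0.
- rewrite (_ : _ + _ = (P + x - I * y - I) * c^-1);
    last by field; rewrite ?t_neq0 ?c_neq0.
  by rewrite Iy (_ : P + x - _ - I = P - t^-1 - I); [integrality | ring].
Qed.

Lemma conic_free_quotient : homomorphic_image (SL 2 conic_ring) F_omega.
Proof.
have [theta thetaE] := tree_morphism O1 OB OM OtV Ot Ounif edge_label_Iw edge_label_iota.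
exists theta; apply: surjective_on_generators (@free_group_generated _) _ => _ [k ->].
exists (link k).
rewrite (thetaE _ _ _ (edge_vertex0 _) (edge_vertex0 _) (link_vertex1 k)).
by rewrite edge_label_one edge_label_radicand mul1g invgK.
Qed.

End ConicTree.

(** * Rational functions regular at the origin *)

Lemma fraction_quotient (R : idomainType) (f : {fraction R}) :
  exists p q : R, q != 0 /\ f = FracField.tofrac p / FracField.tofrac q.
Proof.
elim/quotW: f => r; exists \n_r, \d_r; have d0 := denom_ratioP r; split=> //.
apply: (mulIf (_ : FracField.tofrac \d_r != 0)); first by rewrite tofrac_eq0.
rewrite mulfVK ?tofrac_eq0 //.
rewrite -[LHS]/(FracField.mul _ _) !piE; apply/eqmodP => /=.
by rewrite FracField.equivfE /FracField.mulf !numden_Ratio ?mulr1 ?oner_eq0 // mulrC.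
Qed.

Section RegularFractions.

Variable k : fieldType.

Local Notation K := {fraction {poly k}}.
Local Notation "p %:F" := (FracField.tofrac p : K).

(** The local ring of the affine line at the origin, with uniformizer ['X] in the role of [t^-1]. *)
Definition regular_at0 (f : K) : Prop :=
  exists p q : {poly k}, q.[0] != 0 /\ f = p%:F / q%:F.

Let F0 (p : {poly k}) : p.[0] != 0 -> p%:F != 0.
Proof. by move=> p0; rewrite tofrac_eq0; apply: contraNneq p0 => ->; rewrite horner0. Qed.

Lemma regular_at0B f g : regular_at0 f -> regular_at0 g -> regular_at0 (f - g).
Proof.
move=> [p [q [q0 ->]]] [p' [q' [q'0 ->]]].
exists (p * q' - p' * q), (q * q'); rewrite hornerM mulf_neq0 //; split=> //.
by rewrite -mulNr addf_div ?F0 // mulNr tofracB !tofracM.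
Qed.

Lemma regular_at0M f g : regular_at0 f -> regular_at0 g -> regular_at0 (f * g).
Proof.
move=> [p [q [q0 ->]]] [p' [q' [q'0 ->]]].
exists (p * p'), (q * q'); rewrite hornerM mulf_neq0 //; split=> //.
by rewrite mulf_div !tofracM.
Qed.

Lemma regular_at0_poly p : regular_at0 p%:F.
Proof. by exists p, 1; rewrite hornerC oner_neq0 tofrac1 divr1. Qed.

Let factorX (p : {poly k}) : p != 0 ->
  exists n (q : {poly k}), q.[0] != 0 /\ p = q * 'X ^+ n.
Proof.
move=> p0; have [n [q]] := multiplicity_XsubC p 0.
by rewrite p0 subr0 => /= q0 pE; exists n, q.
Qed.

Lemma regular_at0_uniformizer (f : K) : f != 0 ->
  exists i j u, [/\ regular_at0 u, regular_at0 u^-1 &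
    f * ('X%:F^-1) ^+ i = ('X%:F^-1) ^+ j * u].
Proof.
have [p [q [q0 ->]]] := fraction_quotient f => f0.
have p0 : p != 0 by apply: contraNneq f0 => ->; rewrite tofrac0 mul0r.
have [i [p' [p'0 pE]]] := factorX p0; have [j [q' [q'0 qE]]] := factorX q0.
exists i, j, (p'%:F / q'%:F); split; [by exists p', q' | |].
  by exists q', p'; rewrite invf_div.
have shift (F : fieldType) (a b x : F) : b != 0 -> x != 0 ->
    a * x ^+ i / (b * x ^+ j) * x^-1 ^+ i = x^-1 ^+ j * (a / b).
  by move=> b0 x0; rewrite !exprVn; field; rewrite b0 !expf_neq0.
rewrite pE qE !tofracM !tofracXn shift ?tofrac_eq0 ?polyX_eq0 //.
by rewrite -tofrac_eq0 F0.
Qed.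

(** Clearing denominators gives [c q = p 'X] with [q(0)] nonzero; evaluate at the origin. *)
Lemma regular_at0_residue (c : k) : regular_at0 (c%:P%:F * 'X%:F^-1) -> c = 0.
Proof.
case=> p [q [q0 E]]; have X0 : 'X%:F != 0 by rewrite tofrac_eq0 polyX_eq0.
have cross (F : fieldType) (a b d e : F) : b != 0 -> e != 0 ->
    a * e^-1 = d / b -> a * b = d * e.
  by move=> b0 e0 /eqP; rewrite eqr_div // => /eqP.
have /eqP := cross _ _ _ _ _ (F0 q0) X0 E; rewrite -!tofracM tofrac_eq.
move=> /eqP/(congr1 (horner^~ 0))/eqP.
by rewrite !hornerE /= mulf_eq0 (negPf q0) orbF => /eqP.
Qed.

End RegularFractions.

Lemma SL2_conic_ring_image : homomorphic_image (SL 2 conic_ring) F_omega.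
Proof.
pose kap : {rmorphism algC -> {fraction {poly algC}}} :=
  @FracField.tofrac _ \o polyC.
apply: (@conic_free_quotient _ (@regular_at0 algC) (FracField.tofrac 'X)^-1 kap).
- exact: regular_at0B.
- exact: regular_at0M.
- by rewrite invrK; apply: regular_at0_poly.
- exact: regular_at0_uniformizer.
- by move=> c; apply: regular_at0_poly.
- exact: regular_at0_residue.
Qed.

Theorem corollary3p10 :
  (exists theta : {multiplicative SL 2 conic_ring -> F_omega},
      surjective theta) /\
  (forall G : groupType,
      finitely_generated G \/ countably_generated G ->
      homomorphic_image (SL 2 conic_ring) G) /\
  (forall G : finGroupType, homomorphic_image (SL 2 conic_ring) G).
Proof.
have count (G : groupType) :
    countably_generated G -> homomorphic_image (SL 2 conic_ring) G.
  by move/F_omega_image; apply: homomorphic_image_trans SL2_conic_ring_image.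
split; first exact: SL2_conic_ring_image.
split=> [G [/finitely_generated_countable|]|G]; try exact: count.
exact/count/finitely_generated_countable/finite_generated.
Qed.
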